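(* Let $R$ be a commutative Noetherian ring, let $N \subseteq M$ be finitely generated $R$-modules, let $\mathscr{E}$ be an $R$-submodule of $\mathrm{Hom}_R(M,R)$, and let $X = j\text{-}\mathrm{Spec}(R)$. Assume that for each $\mathfrak{p} \in X$ the module $M_\mathfrak{p}$ contains a free $\mathscr{E}_\mathfrak{p}$-summand $F(\mathfrak{p})$ of rank at least $i + \dim_X(\mathfrak{p})$, for some fixed positive integer $i$. Then $M$ contains a free $\mathscr{E}$-summand $F$ of rank at least $i$. Furthermore, if $F(\mathfrak{p}) \subseteq N_\mathfrak{p}$ for all $\mathfrak{p} \in X$, then $F$ can be chosen with $F \subseteq N$.
   Context: $j\text{-}\mathrm{Spec}(R)$ denotes the set of prime ideals of $R$ that are intersections of maximal ideals. For $X \subseteq \mathrm{Spec}(R)$ and $\mathfrak{p} \in X$, $\dim_X(\mathfrak{p})$ is the supremum of the lengths $n$ of chains $\mathfrak{p} = \mathfrak{p}_0 \subsetneq \cdots \subsetneq \mathfrak{p}_n$ with all $\mathfrak{p}_k \in X$. For a finitely generated $R$-module $M$ and an $R$-submodule $\mathscr{E} \subseteq \mathrm{Hom}_R(M,R)$, a free $\mathscr{E}$-summand of $M$ is a direct summand $F$ of $M$ (say $M = F \oplus G$) with $F \cong R^n$ such that the projection $M \to F \cong R^n$ along $G$ has each of its $n$ coordinate functions in $\mathscr{E}$ (this does not depend on the choice of isomorphism $F \cong R^n$). For a prime $\mathfrak{p}$, $\mathscr{E}_\mathfrak{p}$ is viewed as an $R_\mathfrak{p}$-submodule of $\mathrm{Hom}_{R_\mathfrak{p}}(M_\mathfrak{p},R_\mathfrak{p})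 = \mathrm{Hom}_R(M,R)_\mathfrak{p}$, and free $\mathscr{E}_\mathfrak{p}$-summands of $M_\mathfrak{p}$ are defined analogously over $R_\mathfrak{p}$. *)

(* Defs.v *)
(* Commutative ring R : comPzRingType, R-module M : lmodType R.
   Ideals, submodules and subsets are Prop-valued predicates; localization at a
   prime p is encoded by formal fractions (numerator, denominator) whose
   denominator lies outside p, modulo the usual localization equivalence. *)
From HB Require Import structures.
From mathcomp Require Import all_boot all_algebra.
Set Implicit Arguments. Unset Strict Implicit. Unset Printing Implicit Defensive.
Import GRing.Theory.
Local Open Scope ring_scope.

Section RingDefs.
Variable R : comPzRingType.

Definition is_ideal (I : R -> Prop) : Prop :=
  I 0 /\ (forall x y, I x -> I y -> I (x + y)) /\ (forall r x, I x -> I (r * x)).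

Definition is_prime_ideal (p : R -> Prop) : Prop :=
  is_ideal p /\ ~ p 1 /\ (forall a b, p (a * b) -> p a \/ p b).

Definition is_maximal_ideal (m : R -> Prop) : Prop :=
  is_ideal m /\ ~ m 1 /\
  (forall J : R -> Prop, is_ideal J -> ~ J 1 -> (forall x, m x -> J x) ->
     forall x, J x -> m x).

Definition in_jSpec (p : R -> Prop) : Prop :=
  is_prime_ideal p /\
  exists Fam : (R -> Prop) -> Prop,
    (forall m, Fam m -> is_maximal_ideal m) /\
    (forall x, p x <-> (forall m, Fam m -> m x)).

Definition strict_incl (I J : R -> Prop) : Prop :=
  (forall x, I x -> J x) /\ exists x, J x /\ ~ I x.

Definition chain_in (X : (R -> Prop) -> Prop) (p : R -> Prop) (n : nat) : Prop :=
  exists c : nat -> (R -> Prop),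
    c 0%N = p /\ (forall k, (k <= n)%N -> X (c k)) /\
    (forall k, (k < n)%N -> strict_incl (c k) (c k.+1)).

(* "r >= i + dim_X(p)" (with dim_X(p) a supremum, possibly infinite) *)
Definition rank_ge_plus_dim (X : (R -> Prop) -> Prop) (p : R -> Prop) (i r : nat) :=
  forall n, chain_in X p n -> (i + n <= r)%N.

Definition noetherian : Prop :=
  forall I, is_ideal I -> exists s : seq R,
    forall x, I x <-> exists a : 'I_(size s) -> R, x = \sum_(k < size s) a k * s`_k.

End RingDefs.

Section ModuleDefs.
Variables (R : comPzRingType) (M : lmodType R).

Definition is_submodule (N : M -> Prop) : Prop :=
  N 0 /\ (forall x y, N x -> N y -> N (x + y)) /\ (forall r x, N x -> N (r *: x)).

Definition fin_gen_submodule (N : M -> Prop) : Prop :=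
  exists s : seq M, (forall k, (k < size s)%N -> N s`_k) /\
    forall x, N x <-> exists a : 'I_(size s) -> R, x = \sum_(k < size s) a k *: s`_k.

Definition fin_gen_module : Prop := fin_gen_submodule (fun _ => True).

Definition is_R_linear (f : M -> R) : Prop :=
  forall a x y, f (a *: x + y) = a * f x + f y.

Definition is_Hom_submodule (E : (M -> R) -> Prop) : Prop :=
  (forall f, E f -> is_R_linear f) /\ E (fun _ => 0) /\
  (forall f g, E f -> E g -> E (fun x => f x + g x)) /\
  (forall a f, E f -> E (fun x => a * f x)).

(* F is a free E-summand of M of rank n: M = F (+) G, F has basis b (so
   F ≅ R^n), and the coordinate functions c j of the projection M -> F ≅ R^n
   along G lie in E. *)
Definition free_E_summand (E : (M -> R) -> Prop) (F : M -> Prop) (n : nat) : Prop :=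
  exists (b : 'I_n -> M) (G : M -> Prop) (c : 'I_n -> (M -> R)),
    is_submodule G /\
    (forall x, F x <-> exists a : 'I_n -> R, x = \sum_j a j *: b j) /\
    (forall (a : 'I_n -> R) g, G g -> \sum_j a j *: b j + g = 0 ->
        (forall j, a j = 0) /\ g = 0) /\
    (forall x, G (x - \sum_j c j x *: b j)) /\
    (forall j, E (c j)).

Variable p : R -> Prop.

Definition validR (x : R * R) : Prop := ~ p x.2.
Definition eqRp (x y : R * R) : Prop :=
  exists u, ~ p u /\ u * (y.2 * x.1 - x.2 * y.1) = 0.
Definition validM (x : M * R) : Prop := ~ p x.2.
Definition eqMp (x y : M * R) : Prop :=
  exists u, ~ p u /\ u *: (y.2 *: x.1 - x.2 *: y.1) = 0.
Definition zeroMp : M * R := (0, 1).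
Definition addMp (x y : M * R) : M * R := (y.2 *: x.1 + x.2 *: y.1, x.2 * y.2).
Definition scaleMp (a : R * R) (x : M * R) : M * R := (a.1 *: x.1, a.2 * x.2).
Definition sumMp n (F : 'I_n -> M * R) : M * R := \big[addMp/zeroMp]_(j < n) F j.
(* E_p : fractions (f, s) with f \in E, s \notin p, acting on M_p by
   (f/s)(m/t) = f(m)/(st)  (identification Hom(M,R)_p = Hom(M_p,R_p)) *)
Definition applyEp (phi : (M -> R) * R) (x : M * R) : R * R :=
  (phi.1 x.1, phi.2 * x.2).

Definition is_submodule_p (G : M * R -> Prop) : Prop :=
  (forall x, G x -> validM x) /\
  (forall x y, G x -> validM y -> eqMp x y -> G y) /\
  G zeroMp /\
  (forall x y, G x -> G y -> G (addMp x y)) /\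
  (forall a x, validR a -> G x -> G (scaleMp a x)).

Definition free_Ep_summand (E : (M -> R) -> Prop) (F : M * R -> Prop) (n : nat) : Prop :=
  exists (b : 'I_n -> M * R) (G : M * R -> Prop) (c : 'I_n -> (M -> R) * R),
    (forall j, validM (b j)) /\
    is_submodule_p G /\
    (forall x, F x <-> validM x /\
        exists a : 'I_n -> R * R, (forall j, validR (a j)) /\
          eqMp x (sumMp (fun j => scaleMp (a j) (b j)))) /\
    (forall (a : 'I_n -> R * R) g, (forall j, validR (a j)) -> G g ->
        eqMp (addMp (sumMp (fun j => scaleMp (a j) (b j))) g) zeroMp ->
        (forall j, eqRp (a j) (0, 1)) /\ eqMp g zeroMp) /\
    (forall x, validM x ->
        G (addMp x (scaleMp (-1, 1)
             (sumMp (fun j => scaleMp (applyEp (c j) x) (b j)))))) /\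
    (forall j, E (c j).1 /\ ~ p (c j).2).

Definition in_loc_sub (N : M -> Prop) (x : M * R) : Prop :=
  exists m s, N m /\ ~ p s /\ eqMp x (m, s).

End ModuleDefs.

(* Main.v *)
(** Choose generators x_l of N and f_j of E (E embeds into a power of R, hence is
    finitely generated).  Everything is then encoded by the matrix A = (f_j(x_l)):
    a free E_p-summand of rank r inside N_p forces A to have rank at least r over
    the residue field of p, and matrices P, Q with P A Q = 1 give a free
    E-summand of M inside N.

    By induction on i it suffices to find u, v with u A v = 1, since replacing A by
    A - A v u A lowers each local rank by at most one.  Such a u is a basic element
    in the sense of Eisenbud and Evans: u A must be nonzero modulo every prime
    of X.  Starting with k rows of local rank at least min(k, dim_X(p) + 1), add
    multiples of the first row to the others and drop it.  The rank condition for
    k - 1 rows can only fail at those p where the rank is exactly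
    dim_X(p) + 1 < k; such a p is minimal in X over an ideal of minors, so there
    are finitely many of them, and they are handled one at a time. *)
From HB Require Import structures.
Require Import Defs.
From mathcomp Require Import all_boot all_algebra ring.
From mathcomp Require Import boolp.
Set Implicit Arguments. Unset Strict Implicit. Unset Printing Implicit Defensive.
Import GRing.Theory.
Local Open Scope ring_scope.
Local Open Scope quotient_scope.

(** * Residue fields *)

Section ResidueField.
Variables (R : comPzRingType) (p : R -> Prop) (hp : is_prime_ideal p).

Fact nontrivial_of_prime : (1 : R) != 0.
Proof. by case: hp => [[p0 _] [np1 _]]; apply/eqP => e; apply: np1; rewrite e. Qed.

(* A copy of R depending on hp, so that it can be declared nontrivial. *)
Definition nzcopy : Type := (fun _ : is_prime_ideal p => R : Type) hp.
HB.instance Definition _ := GRing.ComPzRing.copy nzcopy R.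
HB.instance Definition _ := GRing.PzSemiRing_isNonZero.Build nzcopy nontrivial_of_prime.

Definition prime_pred (x : nzcopy) : bool := `[< p x >].

Fact prime_pred_idealr : idealr_closed prime_pred.
Proof.
case: hp => [[p0 [pD pM]] [np1 _]]; split; try exact/asboolP.
by move=> a x y /asboolP px /asboolP py; apply/asboolP/pD => //; apply: pM.
Qed.

Fact prime_pred_prime : prime_idealr_closed prime_pred.
Proof.
case: hp => [_ [_ pM]] x y /asboolP pxy; case: (pM _ _ pxy) => h; apply/orP.
  by left; apply/asboolP.
by right; apply/asboolP.
Qed.

HB.instance Definition _ := isIdealr.Build nzcopy prime_pred prime_pred_idealr.
HB.instance Definition _ :=
  isPrimeIdealrClosed.Build nzcopy prime_pred prime_pred_prime.

Definition prime_quot : Type := {ideal_quot (prime_pred : prime_idealr nzcopy)}.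
HB.instance Definition _ := GRing.ComNzRing.on prime_quot.

(** The fraction field construction asks for a domain with a boolean unit predicate and a total
    inverse. Both come from classical choice; the inverse is the identity off the units. *)
Definition quot_unit (x : prime_quot) : bool := `[< exists y, y * x = 1 >].
Definition quot_inv (x : prime_quot) : prime_quot :=
  if pselect (exists y, y * x = 1) is left h then projT1 (cid h) else x.

Fact quot_mulVx : {in quot_unit, left_inverse 1 quot_inv *%R}.
Proof.
move=> x /asboolP h; rewrite /quot_inv; case: pselect => // h'.
exact: projT2 (cid h').
Qed.

Fact quot_unitPl (x y : prime_quot) : y * x = 1 -> quot_unit x.
Proof. by move=> h; apply/asboolP; exists y. Qed.

Fact quot_invr_out : {in [predC quot_unit], quot_inv =1 id}.
Proof. by move=> x /asboolP h; rewrite /quot_inv; case: pselect. Qed.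

HB.instance Definition _ := GRing.ComNzRing_hasMulInverse.Build prime_quot
  quot_mulVx quot_unitPl quot_invr_out.

Fact quot_integral : GRing.integral_domain_axiom prime_quot.
Proof. exact: Quotient.rquot_IdomainAxiom. Qed.

HB.instance Definition _ :=
  GRing.ComUnitRing_isIntegral.Build prime_quot quot_integral.

(** The field is the fraction field of [R/p], reached through the quotient map. It turns rank
    conditions at [p] into linear algebra over a field without localizing [R]. *)
Lemma residue_field :
  exists (K : fieldType) (phi : {rmorphism R -> K}), forall x, p x <-> phi x = 0.
Proof.
pose I : idealr nzcopy := prime_pred.
pose pi : {rmorphism nzcopy -> {ideal_quot I}} := \pi_{ideal_quot I}.
pose pi' : {rmorphism R -> prime_quot} := pi.
pose f : {rmorphism prime_quot -> {fraction prime_quot}} := @FracField.tofrac prime_quot.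
exists {fraction prime_quot}, (f \o pi')%FUN => x.
have -> : (f (pi' x) = 0) <-> (pi' x == 0).
  by rewrite -tofrac_eq0; split => [->//|/eqP].
have -> : (pi' x == 0) = prime_pred x.
  rewrite -(rmorph0 pi') -[x in RHS]subr0; exact/esym/Quotient.idealrBE.
by split => [/asboolP|/asboolP].
Qed.
End ResidueField.

(** * Rank at a prime *)

(** Rank over the residue field, phrased by minors so that it mentions only [R] and [p]. The maps
    [f] and [g] may repeat indices: such a minor vanishes, hence lies in [p]. *)
Definition rk_ge (R : comPzRingType) (p : R -> Prop) k n (A : 'M[R]_(k, n)) t :=
  exists (f : 'I_t -> 'I_k) (g : 'I_t -> 'I_n), ~ p (\det (mxsub f g A)).

(** * Matrix ranks over a field *)

Section LinearAlgebra.
Variable K : fieldType.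

Lemma mxrank_mxsub m n k l (f : 'I_k -> 'I_m) (g : 'I_l -> 'I_n) (A : 'M[K]_(m, n)) :
  (\rank (mxsub f g A) <= \rank A)%N.
Proof.
have -> : mxsub f g A = rowsub f 1%:M *m (A *m colsub g 1%:M).
  by rewrite -rowsubE mulmx_colsub mulmx1; apply/matrixP => i j; rewrite !mxE.
exact: leq_trans (mxrankM_maxr _ _) (mxrankM_maxl _ _).
Qed.

(** Keep [t] rows out of a maximal independent family; the transpose of the resulting row-free
    matrix is row-full, so [t] independent columns can be selected as well. *)
Lemma rank_minor m n (A : 'M[K]_(m, n)) t : (t <= \rank A)%N ->
  exists (f : 'I_t -> 'I_m) (g : 'I_t -> 'I_n), \det (mxsub f g A) != 0.
Proof.
move=> le_t; pose h : 'I_t -> 'I_(\rank A) := widen_ord le_t.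
pose f := maxrankfun A \o h; pose C := rowsub f A.
have freeC : row_free C.
  have -> : C = rowsub h 1%:M *m rowsub (maxrankfun A) A.
    by rewrite -rowsubE; apply/matrixP => i j; rewrite !mxE.
  rewrite /row_free mxrankMfree ?maxrowsub_free //; apply/row_freeP.
  exists (colsub h 1%:M); rewrite -rowsubE; apply/matrixP => i j.
  by rewrite !mxE -!val_eqE.
have fullC : row_full C^T by rewrite /row_full mxrank_tr.
exists f, (fullrankfun fullC); rewrite -unitfE -unitmxE -unitmx_tr.
suff -> : (mxsub f (fullrankfun fullC) A)^T = rowsub (fullrankfun fullC) C^T.
  exact: fullrowsub_unit.
by apply/matrixP => i j; rewrite !mxE.
Qed.

(** The row [c] and the rows of [B] all lie in the span of [c] and the rows of [B + a *m c], where
    [c] accounts for at most one dimension. *)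
Lemma rank_col_mx_le k n (c : 'rV[K]_n) (B : 'M[K]_(k, n)) (a : 'cV[K]_k) :
  (\rank (col_mx c B) <= (\rank (B + a *m c)%R).+1)%N.
Proof.
have h : (col_mx c B <= c + (B + a *m c)%R)%MS.
  rewrite col_mx_sub addsmxSl /= -[X in (X <= _)%MS](addrK (a *m c) B).
  by rewrite addmx_sub ?addsmxSr // eqmx_opp (submx_trans (submxMl _ _)) ?addsmxSl.
rewrite (leq_trans (mxrankS h)) // (leq_trans (mxrank_adds_leqif _ _)) //.
by rewrite -[X in (_ <= X)%N]add1n leq_add2r rank_leq_row.
Qed.

Lemma rank_col_mx_fix k n (c : 'rV[K]_n) (B : 'M[K]_(k, n)) (rho : K) :
  rho != 0 -> (\rank (col_mx c B) <= k)%N ->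
  (\rank (col_mx c B) <= \rank B)%N \/
  exists j, (\rank (col_mx c B) <= \rank (B + rho *: delta_mx j 0 *m c)%R)%N.
Proof.
move=> rho0 le_k; case: (boolP (c <= B)%MS) => [cB | ncB].
  by left; apply: mxrankS; rewrite col_mx_sub cB submx_refl.
(* If [B] had rank [k], the bound [le_k] would make its row space equal to that of [col_mx c B],
   which contains [c]. *)
right; have nfree : kermx B != 0.
  rewrite kermx_eq0; apply: contra ncB => /eqP rB; apply: submx_trans (_ : _ <= col_mx c B)%MS _.
    by have := submx_refl (col_mx c B); rewrite {1}col_mx_sub => /andP[].
  have BS : (B <= col_mx c B)%MS.
    by have := submx_refl (col_mx c B); rewrite {1}col_mx_sub => /andP[].
  have := geq_leqif (mxrank_leqif_eq BS).
  by rewrite rB le_k => /esym/andP[].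
have /rowV0Pn [v /sub_kermxP vB v0] := nfree.
have [j vj] : exists j, v 0 j != 0 by apply/rV0Pn.
exists j; apply: mxrankS; set B' := (B + _)%R.
have cB' : (c <= B')%MS.
  have e : v *m B' = (rho * v 0 j) *: c.
    rewrite mulmxDr vB add0r mulmxA -scalemxAr -colE.
    by rewrite [col j v]mx11_scalar mxE -scalemxAl mul_scalar_mx scalerA.
  have := submxMl v B'; rewrite e => /(scalemx_sub (rho * v 0 j)^-1).
  by rewrite scalerA mulVf ?scale1r // mulf_neq0.
rewrite col_mx_sub cB' /= -[X in (X <= _)%MS](addrK (rho *: delta_mx j 0 *m c) B).
by rewrite addmx_sub // eqmx_opp (submx_trans (submxMl _ _)).
Qed.
End LinearAlgebra.

Section RankAt.
Variables (R : comPzRingType) (p : R -> Prop).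

Lemma rk_ge_mxrank (K : fieldType) (phi : {rmorphism R -> K}) k n (A : 'M[R]_(k, n)) t :
  (forall x, p x <-> phi x = 0) -> rk_ge p A t <-> (t <= \rank (map_mx phi A))%N.
Proof.
move=> ker; split=> [[f [g nz]]|/rank_minor [f [g /eqP nz]]]; last first.
  by exists f, g => /ker e; apply: nz; rewrite -map_mxsub det_map_mx.
apply: leq_trans (mxrank_mxsub f g _); rewrite -map_mxsub mxrank_unit //.
by rewrite unitmxE unitfE det_map_mx; apply/eqP => /ker.
Qed.

Hypothesis hp : is_prime_ideal p.

Lemma rk_ge_leq k n (A : 'M[R]_(k, n)) s t : (s <= t)%N -> rk_ge p A t -> rk_ge p A s.
Proof.
have [K [phi ker]] := residue_field hp => st.
by rewrite !(rk_ge_mxrank _ _ ker); apply: leq_trans.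
Qed.

(** The equivalence pins down the exact local rank [t] without naming a residue field; later
    statements use it as the way to say that the rank equals [t]. *)
Lemma rk_ge_max k n (A : 'M[R]_(k, n)) :
  exists2 t, (t <= k)%N & forall s, rk_ge p A s <-> (s <= t)%N.
Proof.
have [K [phi ker]] := residue_field hp.
by exists (\rank (map_mx phi A)) => [|s]; rewrite ?rank_leq_row ?(rk_ge_mxrank _ _ ker).
Qed.

Lemma rk_ge_addrow k n (c : 'rV[R]_n) (B : 'M[R]_(k, n)) (a : 'cV[R]_k) t :
  rk_ge p (col_mx c B) t.+1 -> rk_ge p (B + a *m c) t.
Proof.
have [K [phi ker]] := residue_field hp.
rewrite !(rk_ge_mxrank _ _ ker) map_col_mx map_mxD map_mxM => h.
exact: leq_trans h (rank_col_mx_le _ _ _).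
Qed.

(* A vector v with v B = 0 and v_j != 0 modulo p shows that adding a multiple of c to
   the j-th row of B brings c into the row space. *)
Lemma rk_ge_fix k n (c : 'rV[R]_n) (B : 'M[R]_(k, n)) r t :
  ~ p r -> (t <= k)%N -> (forall s, rk_ge p (col_mx c B) s <-> (s <= t)%N) ->
  rk_ge p B t \/ exists j, rk_ge p (B + r *: delta_mx j 0 *m c) t.
Proof.
have [K [phi ker]] := residue_field hp => npr tk h.
have rt : \rank (map_mx phi (col_mx c B)) = t.
  apply/eqP; rewrite eqn_leq; apply/andP; split.
    by apply/h; rewrite (rk_ge_mxrank _ _ ker).
  by rewrite -(rk_ge_mxrank _ _ ker); apply/h.
have phir : phi r != 0 by apply/eqP => /ker.
have := @rank_col_mx_fix K k n (map_mx phi c) (map_mx phi B) (phi r) phir.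
rewrite -map_col_mx rt => /(_ tk) [hB|[j hj]].
  by left; apply/(rk_ge_mxrank _ _ ker).
right; exists j; apply/(rk_ge_mxrank _ _ ker).
by rewrite map_mxD map_mxM map_mxZ map_delta_mx.
Qed.

(** The subtracted matrix factors through the single column [A *m v], so it has rank at most one. *)
Lemma rk_ge_residual k n (A : 'M[R]_(k, n)) (u : 'rV_k) (v : 'cV_n) t :
  rk_ge p A t.+1 -> rk_ge p (A - A *m v *m (u *m A)) t.
Proof.
have [K [phi ker]] := residue_field hp.
rewrite !(rk_ge_mxrank _ _ ker) map_mxB !map_mxM; set A' := map_mx phi A.
set x := _ *m _ *m _ => h; have : (\rank A' <= \rank (A' - x)%R + \rank x)%N.
  rewrite -{1}[A'](subrK x); exact: mxrank_add.
have : (\rank x <= 1)%N.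
  by apply: leq_trans (mxrankM_maxl _ _) _; apply: rank_leq_col.
move=> h1 h2; rewrite -ltnS (leq_trans h) // (leq_trans h2) //.
by rewrite -addn1 leq_add2l.
Qed.

Lemma rk_ge_mul k n s t (A : 'M[R]_(k, n)) (U : 'M_(s, k)) (W : 'M_(n, t)) r :
  rk_ge p (U *m A *m W) r -> rk_ge p A r.
Proof.
have [K [phi ker]] := residue_field hp.
rewrite !(rk_ge_mxrank _ _ ker) !map_mxM => h; apply: (leq_trans h).
exact: leq_trans (mxrankM_maxl _ _) (mxrankM_maxr _ _).
Qed.
End RankAt.

(** * Ideals of Noetherian rings *)

Section Ideals.
Variable R : comPzRingType.
Implicit Types (I J p q m : R -> Prop).

Lemma ideal_sum I n (F : 'I_n -> R) : is_ideal I -> (forall k, I (F k)) -> I (\sum_k F k).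
Proof. by move=> [I0 [ID _]] h; elim/big_ind: _. Qed.

Lemma maximal_ideal_prime m : is_maximal_ideal m -> is_prime_ideal m.
Proof.
move=> [im [n1 mx]]; split; [by []|split; [by []|]] => a b mab.
case: im (im) => m0 [mD mM] im; apply: or_asboolP; rewrite -implyNb; apply/implyP.
move=> /asboolP na; apply/asboolP.
pose J x := exists r y, m y /\ x = y + r * a.
have iJ : is_ideal J.
  split; [|split].
  - by exists 0, 0; split=> //; rewrite mul0r addr0.
  - move=> _ _ [r [y [my ->]]] [s [z [mz ->]]]; exists (r + s), (y + z).
    by split; [exact: mD | rewrite mulrDl addrACA].
  - move=> t _ [r [y [my ->]]]; exists (t * r), (t * y).
    by split; [exact: mM | rewrite mulrDr mulrA].
have [[r [y [my e]]]|nJ1] := pselect (J 1).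
  rewrite -[b]mulr1 e mulrDr mulrCA [b * a]mulrC.
  by apply: mD; apply: mM.
case: na; apply: (mx J iJ nJ1) => [x mx0|].
  by exists 0, x; rewrite mul0r addr0.
by exists 1, 0; rewrite mul1r add0r.
Qed.

Lemma maximal_in_jSpec m : is_maximal_ideal m -> in_jSpec m.
Proof.
move=> hm; split; first exact: maximal_ideal_prime.
exists (eq m); split=> [_ <-//|x]; split=> [mx _ <-//|]; exact.
Qed.

Lemma strict_incl_or_eq I J : (forall x, I x -> J x) -> strict_incl I J \/ I = J.
Proof.
move=> IJ; have [h|h] := pselect (exists x, J x /\ ~ I x); first by left.
right; apply/funext => x; apply/propext; split=> [|Jx]; first exact: IJ.
by apply: contrapT => nIx; apply: h; exists x.
Qed.

Lemma seq_minimal (L : seq (R -> Prop)) : L != [::] ->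
  exists2 m, m \in L & forall q, q \in L -> (forall x, q x -> m x) -> q = m.
Proof.
elim: L => // p [|q L] IH _.
  by exists p; rewrite ?mem_head // => q; rewrite inE => /eqP.
have [//|m mL hm] := IH.
have [pm|npm] := pselect (forall x, p x -> m x).
  exists p; rewrite ?mem_head // => q'; rewrite inE => /predU1P[//|q'L] q'p.
  have q'm : q' = m by apply: hm => // x /q'p/pm.
  by apply/funext => x; apply/propext; split=> [/q'p//|/pm]; rewrite q'm.
exists m; first by rewrite inE mL orbT.
by move=> q'; rewrite inE => /predU1P[->//|]; apply: hm.
Qed.

(** Multiply one element of each [q] outside [m]; the product stays outside the prime [m]. *)
Lemma prime_avoid_seq m (L : seq (R -> Prop)) : is_prime_ideal m ->
  (forall q, q \in L -> is_ideal q /\ exists x, q x /\ ~ m x) ->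
  exists r, ~ m r /\ forall q, q \in L -> q r.
Proof.
move=> [_ [n1 mM]]; elim: L => [|q L IH] h; first by exists 1.
have [|r [nr hr]] := IH; first by move=> q' q'L; apply: h; rewrite inE q'L orbT.
have [[_ [_ iM]] [x [qx nx]]] := h q (mem_head _ _).
exists (r * x); split=> [/mM[]//|q']; rewrite inE => /predU1P[->|q'L]; first exact: iM.
have [[_ [_ iM']] _] : is_ideal q' /\ exists x, q' x /\ ~ m x.
  by apply: h; rewrite inE q'L orbT.
by rewrite mulrC; apply: iM'; apply: hr.
Qed.

Hypothesis noethR : noetherian R.

(** A counterexample yields, by dependent choice, a strictly increasing sequence of ideals. Its
    union is finitely generated, and the largest index needed for a generator gives a term that
    already equals the union. *)
Lemma noetherian_ind (P : (R -> Prop) -> Prop) :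
  (forall I, is_ideal I -> (forall J, is_ideal J -> strict_incl I J -> P J) -> P I) ->
  forall I, is_ideal I -> P I.
Proof.
move=> step I0 iI0; apply: contrapT => nP0.
pose T := {I : R -> Prop | is_ideal I /\ ~ P I}.
have next (x : T) : {y : T | strict_incl (sval x) (sval y)}.
  apply: cid; case: x => I [iI nPI] /=; apply: contrapT => h.
  apply: nPI; apply: step => // J iJ IJ; apply: contrapT => nPJ.
  by apply: h; exists (exist _ J (conj iJ nPJ)).
have [f [_ fS]] := dependent_choice next (exist _ I0 (conj iI0 nP0)).
pose C n := sval (f n); have iC n : is_ideal (C n) by case: (svalP (f n)).
have monoC a b x : (a <= b)%N -> C a x -> C b x.
  by move=> /subnK <-; elim: (b - a)%N => // d IH /IH; apply: (fS _).1.
pose U x := exists n, C n x.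
have iU : is_ideal U.
  split; first by exists 0%N; case: (iC 0%N).
  split=> [x y [a ax] [b bx]|r x [a ax]].
    exists (maxn a b); apply: (iC _).2.1.
      by apply: monoC ax; apply: leq_maxl.
    by apply: monoC bx; apply: leq_maxr.
  by exists a; apply: (iC _).2.2.
have [s hs] := noethR iU.
have /choice [N hN] (k : 'I_(size s)) : exists n, C n s`_k.
  apply/hs; exists (fun j => (j == k)%:R); rewrite (bigD1 k) //= eqxx mul1r.
  by rewrite big1 ?addr0 // => j /negPf ->; rewrite mul0r.
have [x [xS nx]] := (fS (\max_k N k)%N).2; apply: nx.
have [a ->] : exists a : 'I_(size s) -> R, x = \sum_k a k * s`_k.
  by apply/hs; exists (\max_k N k).+1.
apply: ideal_sum (iC _) _ => k; apply: (iC _).2.2.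
by apply: monoC (hN k); apply: leq_bigmax.
Qed.

Lemma exists_maximal_ideal I : is_ideal I -> ~ I 1 ->
  exists2 m, is_maximal_ideal m & forall x, I x -> m x.
Proof.
move: I; apply: noetherian_ind => I iI IH nI1.
have [h|h] := pselect (exists J, [/\ is_ideal J, ~ J 1 & strict_incl I J]).
  have [J [iJ nJ IJ]] := h; have [m mm Jm] := IH J iJ IJ nJ.
  by exists m => // x /IJ.1; apply: Jm.
exists I => //; split; [by []|split; [by []|]] => J iJ nJ IJ x Jx.
apply: contrapT => nIx; apply: h; exists J; split=> //; split=> //.
by exists x.
Qed.

(** A proper ideal lies in a maximal ideal, and maximal ideals belong to the j-spectrum. *)
Lemma ideal_unit I : is_ideal I ->
  (forall p, in_jSpec p -> exists2 x, I x & ~ p x) -> I 1.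
Proof.
move=> iI h; apply: contrapT => /(exists_maximal_ideal iI) [m mm Im].
by have [x /Im] := h m (maximal_in_jSpec mm).
Qed.

(** By Noetherian induction. If [I] is an intersection of maximal ideals and prime, it is itself the
    only minimal element. If it is not prime, take [a * b] in [I] with neither factor in [I]: every
    prime over [I] lies over [I + (a)] or [I + (b)]. *)
Lemma finite_minimal_jSpec I : is_ideal I ->
  exists L : seq (R -> Prop),
    (forall q, q \in L -> in_jSpec q /\ forall x, I x -> q x) /\
    (forall q, in_jSpec q -> (forall x, I x -> q x) ->
       exists2 m, m \in L & forall x, m x -> q x).
Proof.
move: I; apply: noetherian_ind => I iI IH.
(* Primes of X containing I also contain the intersection J of the maximal ideals
   over I. *)
pose J x := forall m, is_maximal_ideal m -> (forall y, I y -> m y) -> m x.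
have iJ : is_ideal J.
  split; [|split]; first by move=> m [[m0 _] _] _.
    by move=> x y Jx Jy m hm Im; apply: hm.1.2.1; [apply: Jx | apply: Jy].
  by move=> r x Jx m hm Im; apply: hm.1.2.2; apply: Jx.
have Jq q : in_jSpec q -> (forall x, I x -> q x) -> forall x, J x -> q x.
  move=> [_ [Fam [Fm Fq]]] Iq x Jx; apply/Fq => m mF; apply: Jx; first exact: Fm.
  by move=> y /Iq /Fq; apply.
have [|IJ|eIJ] := @strict_incl_or_eq I J; first by move=> x Ix m _; apply.
  have [L [LJ Lmin]] := IH J iJ IJ; exists L; split=> [q /LJ[qX Jq']|q qX Iq].
    by split=> // x /IJ.1; apply: Jq'.
  by apply: Lmin => //; apply: Jq.
have [I1|nI1] := pselect (I 1).
  exists [::]; split=> // q [[_ [nq1 _]] _] /(_ _ I1); exact.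
have [h|h] := pselect (forall a b, I (a * b) -> I a \/ I b).
  exists [:: I]; split=> [q|q _ Iq]; last by exists I; rewrite ?mem_head.
  rewrite inE => /eqP ->; split=> //; split=> //.
  exists (fun m => is_maximal_ideal m /\ forall y, I y -> m y); split=> [m []//|x].
  split=> [Ix m [_ Im]|hx]; first exact: Im.
  by rewrite eIJ => m hm Im; apply: hx.
have [a [b [Iab [na nb]]]] : exists a b, I (a * b) /\ ~ I a /\ ~ I b.
  apply: contrapT => h'; apply: h => a b Iab; apply: contrapT => n; apply: h'.
  by exists a, b; split=> //; split=> ?; apply: n; [left | right].
pose add c x := exists r y, I y /\ x = y + r * c.
have iadd c : is_ideal (add c).
  case: iI => I0 [ID IM]; split; [|split].
  - by exists 0, 0; split=> //; rewrite mul0r addr0.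
  - move=> _ _ [r [y [my ->]]] [s [z [mz ->]]]; exists (r + s), (y + z).
    by split; [exact: ID | rewrite mulrDl addrACA].
  - move=> t _ [r [y [my ->]]]; exists (t * r), (t * y).
    by split; [exact: IM | rewrite mulrDr mulrA].
have Iadd c x : I x -> add c x by exists 0, x; rewrite mul0r addr0.
have addc c : add c c by exists 1, 0; rewrite mul1r add0r; split=> //; case: iI.
have sadd c : ~ I c -> strict_incl I (add c).
  by move=> nc; split=> [x|]; [apply: Iadd | exists c].
have addq c q : is_ideal q -> (forall x, I x -> q x) -> q c -> forall x, add c x -> q x.
  by move=> [_ [qD qM]] Iq qc _ [r [y [/Iq qy ->]]]; apply: qD => //; apply: qM.
have [La [LaI Lam]] := IH _ (iadd a) (sadd a na).
have [Lb [LbI Lbm]] := IH _ (iadd b) (sadd b nb).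
exists (La ++ Lb); split=> [q|q qX Iq].
  rewrite mem_cat => /orP[/LaI|/LbI] [qX sq]; split=> // x Ix; exact/sq/Iadd.
have [iq [_ qM]] := qX.1.
have [qa|qb] := qM _ _ (Iq _ Iab).
  have [m mL mq] := Lam q qX (addq _ _ iq Iq qa).
  by exists m => //; rewrite mem_cat mL.
have [m mL mq] := Lbm q qX (addq _ _ iq Iq qb).
by exists m => //; rewrite mem_cat mL orbT.
Qed.
End Ideals.

(** * Basic elements *)

Section BasicElement.
Variable R : comPzRingType.
Implicit Types (I J p q m : R -> Prop).

Lemma rk_ge_congr p k n (A C : 'M[R]_(k, n)) r t : is_prime_ideal p -> p r ->
  rk_ge p A t -> rk_ge p (A + r *: C) t.
Proof.
move=> hp pr; have [K [phi ker]] := residue_field hp.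
rewrite !(rk_ge_mxrank _ _ ker) map_mxD map_mxZ.
by have /ker -> := pr; rewrite scale0r addr0.
Qed.

Lemma rk_ge_addrow_col p k n (c : 'rV[R]_n) (B : 'M[R]_(k, n)) (a : 'cV[R]_k) s :
  is_prime_ideal p ->
  rk_ge p (col_mx c (B + a *m c)) s <-> rk_ge p (col_mx c B) s.
Proof.
move=> hp; split=> h.
  apply: (rk_ge_mul hp (U := block_mx 1%:M 0 a 1%:M) (W := 1%:M)).
  by rewrite mulmx1 mul_block_col !mul1mx mul0mx addr0 addrC.
apply: (rk_ge_mul hp (U := block_mx 1%:M 0 (- a) 1%:M) (W := 1%:M)).
by rewrite mulmx1 mul_block_col !mul1mx mul0mx addr0 mulNmx addrC addrK.
Qed.

(** Induction on the length of [L]: treat all primes except a minimal one [m], then repair [m] by a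
    multiple of [c] that vanishes modulo the others. Minimality of [m] ensures that no other prime
    of [L] is contained in [m]. *)
Lemma adjust_finite_primes (L : seq (R -> Prop)) k n (c : 'rV[R]_n) (B : 'M[R]_(k, n)) :
  (forall q, q \in L -> is_prime_ideal q) ->
  exists a : 'cV_k, forall q, q \in L -> forall t, (t <= k)%N ->
    (forall s, rk_ge q (col_mx c B) s <-> (s <= t)%N) -> rk_ge q (B + a *m c) t.
Proof.
move: {2}(size L) (leqnn (size L)) => l; elim: l L => [|l IH] L.
  by rewrite leqn0 size_eq0 => /eqP -> _; exists 0.
have [-> _ _|L0 sL pL] := eqVneq L [::]; first by exists 0.
have [m mL mmin] := seq_minimal L0; have hm := pL m mL.
pose L' := [seq q <- L | q != m].
have sL' : (size L' <= l)%N.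
  rewrite -ltnS (leq_trans _ sL) // size_filter -(count_predC (pred1 m)).
  by rewrite -[X in (X < _)%N]add0n ltn_add2r -has_count has_pred1.
have [|a ha] := IH L' sL'; first by move=> q; rewrite mem_filter => /andP[_ /pL].
have [T _ hT] := rk_ge_max hm (col_mx c B).
have uniqT t : (forall s, rk_ge m (col_mx c B) s <-> (s <= t)%N) -> t = T.
  by move=> ht; apply/eqP; rewrite eqn_leq; apply/andP; split; [apply/hT/ht | apply/ht/hT].
(* If the rank [T] at [m] exceeds [k], nothing is claimed at [m], because [T] is the only possible
   value of [t] there. *)
have [Tk|kT] := leqP T k; last first.
  exists a => q qL t tk ht; have [e|nqm] := eqVneq q m.
    by move: kT; rewrite -(uniqT t) ?ltnNge ?tk //; rewrite -e.
  by apply: ha => //; rewrite mem_filter nqm.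
(* Adding r times a row does not affect the primes of L', and m can still be fixed. *)
have [r [nr hr]] : exists r, ~ m r /\ forall q, q \in L' -> q r.
  apply: prime_avoid_seq hm _ => q; rewrite mem_filter => /andP[nqm qL].
  split; first by case: (pL q qL).
  apply: contrapT => h; case/eqP: nqm; apply: mmin => // x qx.
  by apply: contrapT => nx; apply: h; exists x.
have hT' s : rk_ge m (col_mx c (B + a *m c)) s <-> (s <= T)%N.
  by rewrite rk_ge_addrow_col.
have [h|[j hj]] := rk_ge_fix hm nr Tk hT'.
  exists a => q qL t tk ht; have [e|nqm] := eqVneq q m.
    by rewrite e (uniqT t) // -e.
  by apply: ha => //; rewrite mem_filter nqm.
exists (a + r *: delta_mx j 0) => q qL t tk ht.
rewrite mulmxDl addrA; have [e|nqm] := eqVneq q m.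
  by rewrite e (uniqT t) // -e.
have qL' : q \in L' by rewrite mem_filter nqm.
by rewrite -scalemxAl; apply: rk_ge_congr; [apply: pL | apply: hr | apply: ha].
Qed.

Hypothesis noethR : noetherian R.
Notation X := (@in_jSpec R).

Lemma chain_in_cons q p d : X q -> strict_incl q p -> chain_in X p d -> chain_in X q d.+1.
Proof.
move=> qX qp [c [c0 [cX cS]]]; exists (fun k => if k is k'.+1 then c k' else q).
by split=> //; split=> [[|k]|[|k]] //=; [apply: cX | rewrite c0 | apply: cS].
Qed.

Lemma finite_bad_primes k n (A : 'M[R]_(k, n)) t : (t < k)%N ->
  (forall p, X p -> forall d, chain_in X p d -> rk_ge p A (minn k d.+1)) ->
  exists L : seq (R -> Prop), (forall q, q \in L -> X q) /\
    forall p d, X p -> chain_in X p d -> d.+1 = t ->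
      (forall s, rk_ge p A s <-> (s <= t)%N) -> p \in L.
Proof.
move=> tk hA.
(* This intersection of the primes where the rank is at most [t] contains all minors of size
   [t.+1]. *)
pose I x := forall q, X q -> ~ rk_ge q A t.+1 -> q x.
have iI : is_ideal I.
  split; [|split].
  - by move=> q [[[q0 _] _] _] _.
  - move=> x y hx hy q qX nq; have [[_ [qD _]] _] := qX.1.
    by apply: qD; [apply: hx | apply: hy].
  - by move=> r x hx q qX nq; have [[_ [_ qM]] _] := qX.1; apply: qM; apply: hx.
have [L [LI Lmin]] := finite_minimal_jSpec noethR iI.
exists L; split=> [q /LI[]//|p d pX pd edt hp].
have np : ~ rk_ge p A t.+1 by move/hp; rewrite ltnn.
have [|m mL mp] := Lmin p pX; first by move=> x; apply.
have [mX Im] := LI m mL.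
(* If [m] were strictly below [p], the chain from [p] would extend to length [t] from [m]; the
   hypothesis would give a minor of size [t.+1] outside [m], although such minors lie in [I]. *)
have [smp|<-//] := strict_incl_or_eq mp.
have := hA m mX _ (chain_in_cons mX smp pd); rewrite edt (minn_idPr tk).
move=> [f [g h]]; case: h; apply: Im => q qX nq; apply: contrapT => nd.
by apply: nq; exists f, g.
Qed.

Lemma basic_element k n (A : 'M[R]_(k, n)) : (0 < k)%N ->
  (forall p, X p -> forall d, chain_in X p d -> rk_ge p A (minn k d.+1)) ->
  exists u : 'rV_k, forall p, X p -> exists j, ~ p ((u *m A) 0 j).
Proof.
case: k A => // k A _; elim: k A => [|k IH] A hA.
  exists 1%:M => p pX; have [|f [g]] := hA p pX 0%N.
    by exists (fun _ => p).
  rewrite mul1mx => h; exists (g 0); apply: contra_not h.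
  by rewrite det_mx11 mxE (ord1 (f 0)).
pose c : 'rV_n := @usubmx _ 1 k.+1 n A; pose B : 'M_(k.+1, n) := @dsubmx _ 1 k.+1 n A.
have eA : A = col_mx c B by rewrite vsubmxK.
have /choice [L hL] (t : 'I_k.+2) : exists L : seq (R -> Prop),
  (forall q, q \in L -> X q) /\
    forall p d, X p -> chain_in X p d -> d.+1 = t ->
      (forall s, rk_ge p A s <-> (s <= t)%N) -> p \in L.
  exact: finite_bad_primes.
pose LL := flatten [seq L t | t : 'I_k.+2].
have [|a ha] := @adjust_finite_primes LL k.+1 n c B.
  by move=> q /flatten_imageP [t _ /(hL t).1 []].
have [|u hu] := IH (B + a *m c); last first.
  (* A basic combination of the new rows is rewritten as a combination of the original rows, [c]
     included. *)
  have e : (row_mx (u *m a) u : 'rV_(1 + k.+1)) *m A = u *m (B + a *m c).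
    by rewrite eA [LHS]mul_row_col mulmxDr addrC mulmxA.
  by exists (row_mx (u *m a) u) => p /hu; rewrite e.
move=> p pX d pd; have hp := pX.1.
have [t _ ht] := rk_ge_max hp A.
have dt : (minn k.+2 d.+1 <= t)%N by apply/ht/hA.
(* Dropping a row costs at most one in rank. This is harmless if the rank is full or exceeds [d.+1];
   the remaining case of rank exactly [d.+1] is that of the primes collected in [LL]. *)
have [kt|tk] := ltnP k.+1 t.
  apply: rk_ge_addrow => //; rewrite -eA; apply/ht; apply: leq_trans kt.
  by rewrite ltnS geq_minl.
have dt' : (d < t)%N.
  by move: dt; rewrite geq_min; case/orP => // /leq_trans/(_ tk); rewrite ltnn.
have [edt|ndt] := eqVneq d.+1 t.
  have tlt : (t < k.+2)%N by [].
  have := (hL (Ordinal tlt)).2 p d pX pd edt ht => pL.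
  have : rk_ge p (B + a *m c) t.
    apply: ha => //; last by rewrite -eA.
    by apply/flatten_imageP; exists (Ordinal tlt).
  by apply: rk_ge_leq => //; rewrite -edt geq_minr.
apply: rk_ge_addrow => //; rewrite -eA; apply/ht.
by apply: leq_ltn_trans (geq_minr _ _) _; rewrite ltn_neqAle ndt.
Qed.

(** No prime of [X] contains all entries of [u *m A], so these entries generate the unit ideal, and
    [v] holds the coefficients of a combination equal to 1. *)
Lemma exists_unimodular k n (A : 'M[R]_(k, n)) :
  (forall p, X p -> forall d, chain_in X p d -> rk_ge p A d.+1) ->
  exists (u : 'rV_k) (v : 'cV_n), u *m A *m v = 1%:M.
Proof.
move=> hA; have [u hu] : exists u : 'rV_k, forall p, X p -> exists j, ~ p ((u *m A) 0 j).
  have [k0|k0] := posnP k; last first.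
    apply: basic_element => // p pX d pd; apply: rk_ge_leq (hA p pX d pd).
      exact: pX.1.
    exact: geq_minr.
  (* Without rows, rank at least 1 is impossible, so [X] has no element and any [u] will do. *)
  exists 0 => p pX; have [|f _] := hA p pX 0%N; first by exists (fun _ => p).
  by have := ltn_ord (f 0); rewrite [X in (_ < X)%N]k0.
pose I x := exists v : 'cV_n, (u *m A *m v) 0 0 = x.
have [||v hv] := @ideal_unit R noethR I; last first.
- by exists u, v; rewrite [LHS]mx11_scalar hv.
- move=> p /hu [j nj]; exists ((u *m A) 0 j) => //.
  by exists (delta_mx j 0); rewrite -colE mxE.
split; first by exists 0; rewrite mulmx0 mxE.
split=> [_ _ [v <-] [w <-]|r _ [v <-]].
  by exists (v + w); rewrite mulmxDr mxE.
by exists (r *: v); rewrite -scalemxAr mxE.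
Qed.

Lemma unit_block_of_local_rank i k n (A : 'M[R]_(k, n)) :
  (forall p, X p -> forall d, chain_in X p d -> rk_ge p A (i + d)) ->
  exists (P : 'M_(i, k)) (Q : 'M_(n, i)), P *m A *m Q = 1%:M.
Proof.
elim: i A => [|i IH] A hA; first by exists 0, 0; apply/matrixP => -[].
have [|u [v uv]] := @exists_unimodular k n A.
  move=> p pX d /(hA p pX); apply: rk_ge_leq; first exact: pX.1.
  by rewrite addSn ltnS leq_addl.
pose A' := A - A *m v *m (u *m A).
have [|P [Q PQ]] := IH A'.
  by move=> p pX d pd; apply: rk_ge_residual (hA p pX d pd); apply: pX.1.
have A'v : A' *m v = 0 by rewrite mulmxBl -(mulmxA (A *m v)) uv mulmx1 subrr.
have uA' : u *m A' = 0 by rewrite mulmxBr !mulmxA uv mul1mx subrr.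
(* Either factor, [1 - A v u] on the left or [1 - v u A] on the right, turns [A] into [A']. As
   [u A' = 0] and [A' v = 0], the off-diagonal blocks vanish and the diagonal ones are [u A v] and
   [P A' Q]. *)
pose P' : 'M_(1 + i, k) := col_mx u (P *m (1%:M - A *m v *m u)).
pose Q' : 'M_(n, 1 + i) := row_mx v ((1%:M - v *m u *m A) *m Q).
suff PQ' : P' *m A *m Q' = 1%:M by exists P', Q'.
rewrite /P' /Q' mul_col_mx mul_col_row uv.
have e1 : P *m (1%:M - A *m v *m u) *m A = P *m A'.
  by rewrite -mulmxA mulmxBl mul1mx /A' mulmxA.
rewrite e1.
have -> : u *m A *m ((1%:M - v *m u *m A) *m Q) = 0.
  by rewrite mulmxA mulmxBr mulmx1 !mulmxA uv mul1mx subrr mul0mx.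
have -> : P *m A' *m v = 0 by rewrite -mulmxA A'v mulmx0.
have -> : P *m A' *m ((1%:M - v *m u *m A) *m Q) = 1%:M.
  rewrite -PQ mulmxA; congr (_ *m _).
  by rewrite mulmxBr mulmx1 !mulmxA -(mulmxA P A' v) A'v mulmx0 !mul0mx subr0.
by rewrite -scalar_mx_block.
Qed.
End BasicElement.

(** * Localized modules *)

Section LinearForms.
Variables (R : comPzRingType) (M : lmodType R) (f : M -> R).
Hypothesis linf : is_R_linear f.

Lemma R_linear0 : f 0 = 0.
Proof.
have := linf 1 0 0; rewrite scale1r add0r mul1r => /(congr1 (+%R (- f 0))).
by rewrite addNr addKr.
Qed.

Lemma R_linearZ a x : f (a *: x) = a * f x.
Proof. by have := linf a x 0; rewrite !addr0 R_linear0 addr0. Qed.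

Lemma R_linearD x y : f (x + y) = f x + f y.
Proof. by have := linf 1 x y; rewrite scale1r mul1r. Qed.

Lemma R_linear_sum n (a : 'I_n -> R) (x : 'I_n -> M) :
  f (\sum_k a k *: x k) = \sum_k a k * f (x k).
Proof.
rewrite (big_morph f R_linearD R_linear0); apply: eq_bigr => k _; exact: R_linearZ.
Qed.
End LinearForms.

(** * Fractions in [M_p] and dual bases *)

Section Localization.
Variables (R : comPzRingType) (M : lmodType R) (p : R -> Prop).
Hypothesis hp : is_prime_ideal p.
Implicit Types x y z : M * R.

Fact prime_mul_notin a b : ~ p a -> ~ p b -> ~ p (a * b).
Proof. by case: hp => _ [_ pM] na nb /pM[]. Qed.

(** Addition of formal fractions is associative and commutative strictly, not just up to [eqMp], so
    [sumMp] is a big operator over a commutative monoid. *)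
Lemma addMpA : associative (@addMp R M).
Proof.
move=> [x1 x2] [y1 y2] [z1 z2]; rewrite /addMp /= !scalerDr !scalerA !mulrA addrA.
by congr (_ + _ + _, _); congr (_ *: _); ring.
Qed.

Lemma addMpC : commutative (@addMp R M).
Proof. by move=> x y; rewrite /addMp addrC mulrC. Qed.

Lemma add0Mp : left_id (zeroMp M) (@addMp R M).
Proof. by move=> [x1 x2]; rewrite /addMp /= scaler0 add0r scale1r mul1r. Qed.

HB.instance Definition _ :=
  Monoid.isComLaw.Build (M * R)%type (zeroMp M) (@addMp R M) addMpA addMpC add0Mp.

Lemma eqMpP x y : eqMp p x y <-> exists2 u, ~ p u & (u * y.2) *: x.1 = (u * x.2) *: y.1.
Proof.
split=> [[u [nu e]]|[u nu e]]; exists u => //.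
  by move/eqP: e; rewrite scalerBr subr_eq0 !scalerA => /eqP.
by split=> //; rewrite scalerBr !scalerA e subrr.
Qed.

Lemma eqMp_cross x y : y.2 *: x.1 = x.2 *: y.1 -> eqMp p x y.
Proof.
by move=> e; apply/eqMpP; exists 1; [case: hp => _ [] | rewrite !mul1r].
Qed.

Lemma eqMp_trans x y z : validM p y -> eqMp p x y -> eqMp p y z -> eqMp p x z.
Proof.
move=> vy /eqMpP [u nu e] /eqMpP [v nv e']; apply/eqMpP.
(* The denominator of the middle fraction has to be cancelled; this is where validity of [y]
   enters. *)
exists (u * v * y.2); first by do !apply: prime_mul_notin.
have -> : u * v * y.2 * z.2 = v * z.2 * (u * y.2).
  ring.
rewrite -scalerA e scalerA.
have -> : v * z.2 * (u * x.2) = u * x.2 * (v * z.2) by rewrite mulrC.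
rewrite -scalerA e' scalerA; congr (_ *: _).
ring.
Qed.

Lemma eqMp_add x x' y y' : eqMp p x x' -> eqMp p y y' ->
  eqMp p (addMp x y) (addMp x' y').
Proof.
move=> /eqMpP [u nu e] /eqMpP [v nv e']; apply/eqMpP.
exists (u * v); first exact: prime_mul_notin.
rewrite /= !scalerDr !scalerA; congr (_ + _).
  have -> : u * v * (x'.2 * y'.2) * y.2 = v * y'.2 * y.2 * (u * x'.2).
    ring.
  rewrite -scalerA e scalerA; congr (_ *: _).
  ring.
have -> : u * v * (x'.2 * y'.2) * x.2 = u * x'.2 * x.2 * (v * y'.2).
  ring.
rewrite -scalerA e' scalerA; congr (_ *: _).
ring.
Qed.

Lemma eqMp_sum n (F G : 'I_n -> M * R) : (forall l, eqMp p (F l) (G l)) ->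
  eqMp p (sumMp F) (sumMp G).
Proof.
move=> h; rewrite /sumMp; elim/big_ind2: _ => // [|x x' y y']; first exact: eqMp_cross.
exact: eqMp_add.
Qed.

Lemma eqMp_opp x : eqMp p (addMp x (scaleMp (-1, 1) x)) (zeroMp M).
Proof.
by apply: eqMp_cross; rewrite /= mul1r scaler0 scaleN1r scalerN subrr scaler0.
Qed.

Lemma validM_add x y : validM p x -> validM p y -> validM p (addMp x y).
Proof. exact: prime_mul_notin. Qed.

Lemma validM_scale a x : ~ p a.2 -> validM p x -> validM p (scaleMp a x).
Proof. exact: prime_mul_notin. Qed.

Lemma one_notin : ~ p 1. Proof. by case: hp => _ []. Qed.

Lemma validM_sum n (F : 'I_n -> M * R) : (forall l, validM p (F l)) -> validM p (sumMp F).
Proof.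
by move=> h; rewrite /sumMp; elim/big_ind: _ => //; [exact: one_notin | exact: validM_add].
Qed.

Lemma sumMp_pick n (j : 'I_n) (x : M * R) :
  sumMp (fun l => if l == j then x else zeroMp M) = x.
Proof. by rewrite /sumMp -big_mkcond big_pred1_eq. Qed.

(* Uniqueness of coordinates, applied to b_j = sum_l c_l(b_j) b_l + g with g in G,
   shows that (c_l) is dual to (b_l); clearing denominators, the matrix f_b(y_a) is
   then diagonal modulo p with nonzero diagonal. *)
Lemma dual_basis_minor E (N : M -> Prop) F r :
  (forall f, E f -> is_R_linear f) ->
  free_Ep_summand p E F r -> (forall x, F x -> in_loc_sub p N x) ->
  exists (y : 'I_r -> M) (f : 'I_r -> M -> R),
    [/\ forall j, N (y j), forall j, E (f j) & ~ p (\det (\matrix_(a, b) f b (y a)))].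
Proof.
move=> linE [b [G [c [vb [_ [hF [uniq [hG Ec]]]]]]]] FN.
have n1 := one_notin.
have Fb j : F (b j).
  apply/hF; split; first exact: vb.
  exists (fun l => if l == j then (1, 1) else (0, 1)).
  split=> [l|]; first by case: ifP.
  rewrite -{1}(sumMp_pick j (b j)); apply: eqMp_sum => l; apply: eqMp_cross.
  by case: eqP => [->|_] /=; rewrite !(scale1r, scale0r, mul1r, scaler0).
have /choice [ys hys] j : exists ys : M * R, [/\ N ys.1, ~ p ys.2 & eqMp p (b j) ys].
  by have [m [s [Nm [ns e]]]] := FN _ (Fb j); exists (m, s).
have dual j l : exists2 u, ~ p u &
    u * ((c l).1 (b j).1 - (c l).2 * (b j).2 * (l == j)%:R) = 0.
  pose gam l := applyEp (c l) (b j).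
  have vgam k : ~ p (gam k).2 by apply: prime_mul_notin (vb j); case: (Ec k).
  pose a k := ((gam k).1 - (gam k).2 * (k == j)%:R, (gam k).2).
  pose S := sumMp (fun k => scaleMp (gam k) (b k)).
  have Gg : G (addMp (b j) (scaleMp (-1, 1) S)) by apply: hG.
  have vS : validM p S by apply: validM_sum => k; apply: validM_scale.
  have [|] := uniq a _ (fun k => vgam k) Gg; last first.
    move=> /(_ l) [u [nu e]] _; exists u => //.
    by move: e; rewrite /= mul1r mulr0 subr0.
  (* The coordinates [a] are those of [S - b_j], and adding the element [b_j - S] of [G] gives
     zero. *)
  apply: (@eqMp_trans _ (addMp (addMp S (scaleMp (-1, 1) (b j)))
                           (addMp (b j) (scaleMp (-1, 1) S)))).
  - by do !apply: validM_add => //; apply: validM_scale.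
  - apply: eqMp_add; last exact: eqMp_cross.
    rewrite -[scaleMp (-1, 1) (b j)](sumMp_pick j) /S /sumMp -big_split /=.
    apply: eqMp_sum => k; apply: eqMp_cross; rewrite /a; case: eqP => [->|_] /=.
      by rewrite scalerDr !scalerA -scalerDl; congr (_ *: _); ring.
    by rewrite !(mulr0, subr0, scaler0, addr0, mulr1, scale1r).
  have -> : addMp (addMp S (scaleMp (-1, 1) (b j))) (addMp (b j) (scaleMp (-1, 1) S)) =
      addMp (addMp S (scaleMp (-1, 1) S)) (addMp (b j) (scaleMp (-1, 1) (b j))).
    by rewrite -!addMpA; congr (addMp _ _); rewrite [LHS]addMpC [addMp (b j) _]addMpC -addMpA.
  by rewrite -[zeroMp M]add0Mp; apply: eqMp_add; apply: eqMp_opp.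
exists (fun j => (ys j).1), (fun j => (c j).1).
split=> [j|j|]; [by case: (hys j) | by case: (Ec j) |].
have [K [phi ker]] := residue_field hp.
have nz (x : R) : ~ p x -> phi x != 0 by move=> nx; apply/eqP => /ker.
move/ker; rewrite -det_map_mx.
(* The equation [c_j(b_j) = 1] makes the numerator [f_j(y_j)] equal in [K] to the product of the
   denominators of [c_j] and of the fraction [ys j]. *)
set D := map_mx _ _; suff -> : D = diag_mx (\row_j phi ((c j).2 * (ys j).2)).
  rewrite det_diag; apply/eqP/prodf_neq0 => j _; rewrite mxE; apply: nz.
  by have [_ nys _] := hys j; apply: prime_mul_notin => //; case: (Ec j).
apply/matrixP => j l; rewrite !mxE; have [_ _ /eqMpP [v nv e]] := hys j.
have linc := linE _ (Ec l).1.
have {}e : phi (ys j).2 * phi ((c l).1 (b j).1) = phi (b j).2 * phi ((c l).1 (ys j).1).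
  move/(congr1 (fun m : M => phi ((c l).1 m))): e; rewrite !(R_linearZ linc) !rmorphM -!mulrA.
  by move/(mulfI (nz _ nv)).
have [u nu /(congr1 phi)] := dual j l; rewrite rmorph0 rmorphM => /eqP.
rewrite mulf_eq0 (negPf (nz _ nu)) /= rmorphB subr_eq0 => /eqP e'.
apply: (mulfI (nz _ (vb j))); rewrite -e e' !rmorphM rmorph_nat.
by rewrite eq_sym; case: eqP => [->|_]; rewrite ?mulr1n ?mulr0n; ring.
Qed.
End Localization.

(** * From local summands to a global one *)

Section Globalization.
Variable R : comPzRingType.
Hypothesis noethR : noetherian R.

(** Induction on [m]. First coordinates form a finitely generated ideal; lifts [W] of its
    generators, with generators of the vectors of [S] whose first coordinate is 0, generate [S]. *)
Lemma noetherian_rV m (S : 'rV[R]_m -> Prop) : is_submodule S ->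
  exists k (G : 'M_(k, m)), (forall i, S (row i G)) /\
    forall s, S s -> exists u : 'rV_k, s = u *m G.
Proof.
elim: m S => [|m IH] S hS.
  by exists 0%N, 0; split=> [[]//|s _]; exists 0; apply/matrixP => ? [].
move: S hS; rewrite -[m.+1]/(1 + m)%N => S [S0 [SD SZ]].
pose I a := exists v : 'rV_m, S (row_mx a%:M v).
have iI : is_ideal I.
  split; [|split].
  - by exists 0; rewrite raddf0 row_mx0.
  - move=> a b [v Sv] [w Sw]; exists (v + w).
    by rewrite raddfD -add_row_mx; apply: SD.
  - move=> r a [v Sv]; exists (r *: v).
    by rewrite -scale_scalar_mx -scale_row_mx; apply: SZ.
have [s hs] := noethR iI.
have /choice [w hw] (k : 'I_(size s)) : I s`_k.
  apply/hs; exists (fun j => (j == k)%:R); rewrite (bigD1 k) //= eqxx mul1r.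
  by rewrite big1 ?addr0 // => j /negPf ->; rewrite mul0r.
pose W : 'M_(size s, 1 + m) := \matrix_k row_mx (s`_k)%:M (w k).
have SW b : S (b *m W).
  rewrite mulmx_sum_row; elim/big_ind: _ => // k _; apply: SZ.
  by rewrite rowK; apply: hw.
have [|k [G [SG genG]]] := IH (fun v => S (row_mx 0 v)).
  split; [by rewrite row_mx0|split=> [v v' Sv Sv'|r v Sv]].
    by rewrite -[X in row_mx X]addr0 -add_row_mx; apply: SD.
  by rewrite -(scaler0 _ r) -scale_row_mx; apply: SZ.
exists (size s + k)%N, (col_mx W (row_mx 0 G)); split=> [i|v Sv].
  case: (split_ordP i) => j ->; rewrite (rowKu, rowKd).
    by rewrite rowK; apply: hw.
  by rewrite row_row_mx row0; apply: SG.
pose a := lsubmx (v : 'rV_(1 + m)) 0 0.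
have [b eb] : exists b : 'I_(size s) -> R, a = \sum_k b k * s`_k.
  apply/hs; exists (rsubmx (v)).
  by rewrite -mx11_scalar hsubmxK.
pose b' : 'rV_(size s) := \row_k b k.
have l0 : lsubmx (v - b' *m W : 'rV_(1 + m)) = 0.
  apply/rowP => i; rewrite (ord1 i) [RHS]mxE [LHS]mxE [LHS]mxE [X in _ + X]mxE.
  have -> : v 0 (lshift m 0) = a by rewrite /a mxE.
  rewrite mxE eb -sumrB big1 // => j _.
  by rewrite !mxE (unsplitK (inl _)) mxE mulr1n subrr.
have [|u eu] := genG (rsubmx (v - b' *m W)).
  rewrite -l0 hsubmxK; apply: SD => //.
  by rewrite -mulNmx; apply: SW.
exists (row_mx b' u); rewrite mul_row_col mul_mx_row mulmx0 -eu -l0 hsubmxK.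
by rewrite addrC subrK.
Qed.

Variables (M : lmodType R).

Lemma Hom_submodule_sum (E : (M -> R) -> Prop) n (f : 'I_n -> M -> R) (a : 'I_n -> R) :
  is_Hom_submodule E -> (forall j, E (f j)) -> E (fun x => \sum_j a j * f j x).
Proof.
move=> [_ [E0 [ED EZ]]] Ef; elim: (index_enum _) => [|j s IH].
  by have -> : (fun x => \sum_(j <- [::]) a j * f j x) = fun=> 0;
    [apply/funext => x; rewrite big_nil | ].
have -> : (fun x => \sum_(j <- j :: s) a j * f j x) =
    (fun x => a j * f j x + \sum_(j <- s) a j * f j x).
  by apply/funext => x; rewrite big_cons.
by apply: ED => //; apply: EZ.
Qed.

Lemma submodule_sum (N : M -> Prop) n (x : 'I_n -> M) (a : 'I_n -> R) :
  is_submodule N -> (forall j, N (x j)) -> N (\sum_j a j *: x j).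
Proof.
by move=> [N0 [ND NZ]] Nx; elim/big_ind: _ => // j _; apply: NZ.
Qed.

(** A linear form is determined by its values on generators of [M], so generators of the image of
    [val] lift to generators of [E]. *)
Lemma Hom_submodule_fg (E : (M -> R) -> Prop) : fin_gen_module M -> is_Hom_submodule E ->
  exists n (e : 'I_n -> M -> R), (forall j, E (e j)) /\
    forall f, E f -> exists w : 'I_n -> R, forall x, f x = \sum_j w j * e j x.
Proof.
move=> [s [_ gens]] hE; have [linE [E0 [ED EZ]]] := hE.
pose val (f : M -> R) : 'rV_(size s) := \row_k f s`_k.
have [|n [G [EG genG]]] := @noetherian_rV (size s) (fun r => exists2 f, E f & val f = r).
  split; first by exists (fun=> 0) => //; apply/rowP => k; rewrite !mxE.
  split=> [_ _ [f Ef <-] [g Eg <-]|a _ [f Ef <-]].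
    by exists (fun x => f x + g x); [exact: ED | apply/rowP => k; rewrite !mxE].
  by exists (fun x => a * f x); [exact: EZ | apply/rowP => k; rewrite !mxE].
have /choice [e he] (j : 'I_n) : exists f, E f /\ val f = row j G.
  by have [f Ef vf] := EG j; exists f.
exists n, e; split=> [j|f Ef]; first by case: (he j).
have [|u hu] := genG (val f); first by exists f.
exists (u 0) => x; have [b ->] := (gens x).1 I.
rewrite (R_linear_sum (linE f Ef)).
under [RHS]eq_bigr => j _ do rewrite (R_linear_sum (linE _ (he j).1)) mulr_sumr.
rewrite exchange_big /=; apply: eq_bigr => k _.
under eq_bigr => j _ do rewrite mulrCA.
rewrite -mulr_sumr; congr (_ * _).
have /rowP/(_ k) := hu; rewrite !mxE => ->; apply: eq_bigr => j _.
by have [_ /rowP/(_ k)] := he j; rewrite !mxE => ->.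
Qed.

(** The complement is the common kernel of the forms [f j]; duality makes the [f j] read off
    coordinates along the [y j]. *)
Lemma free_summand_of_dual_bases (E : (M -> R) -> Prop) (N : M -> Prop) i
    (y : 'I_i -> M) (f : 'I_i -> M -> R) :
  is_Hom_submodule E -> is_submodule N ->
  (forall j, N (y j)) -> (forall j, E (f j)) ->
  (forall j l, f l (y j) = (j == l)%:R) ->
  exists F, free_E_summand E F i /\ forall x, F x -> N x.
Proof.
move=> [linE _] hN Ny Ef dual.
have fy a l : f l (\sum_j a j *: y j) = a l.
  rewrite (R_linear_sum (linE _ (Ef l))) (bigD1 l) //= dual eqxx mulr1.
  by rewrite big1 ?addr0 // => j /negPf jl; rewrite dual jl mulr0.
exists (fun x => exists a : 'I_i -> R, x = \sum_j a j *: y j); split; last first.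
  by move=> _ [a ->]; apply: submodule_sum.
exists y, (fun x => forall l, f l x = 0), f; split; [|split; [|split; [|split]]] => //.
- split=> [l|]; first exact: R_linear0 (linE _ (Ef l)).
  split=> [x x' hx hx' l|r x hx l].
    by rewrite (R_linearD (linE _ (Ef l))) hx hx' addr0.
  by rewrite (R_linearZ (linE _ (Ef l))) hx mulr0.
- move=> a g hg e; have a0 l : a l = 0.
    have /(congr1 (f l)) := e.
    by rewrite (R_linearD (linE _ (Ef l))) fy hg addr0 (R_linear0 (linE _ (Ef l))).
  by split=> //; move: e; rewrite big1 ?add0r // => j _; rewrite a0 scale0r.
move=> x l; rewrite addrC -scaleN1r (linE _ (Ef l)) fy mulN1r.
by rewrite addNr.
Qed.

Lemma free_summand_in_submodule (N : M -> Prop) (E : (M -> R) -> Prop) i :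
  fin_gen_module M -> is_submodule N -> fin_gen_submodule N -> is_Hom_submodule E ->
  (forall p : R -> Prop, in_jSpec p ->
      exists (Fp : M * R -> Prop) (r : nat),
        rank_ge_plus_dim (@in_jSpec R) p i r /\ free_Ep_summand p E Fp r /\
        (forall x, Fp x -> in_loc_sub p N x)) ->
  exists F, free_E_summand E F i /\ forall x, F x -> N x.
Proof.
move=> fgM hN [s [Ns gens]] hE loc; have linE := hE.1.
have [n [e [Ee gene]]] := Hom_submodule_fg fgM hE.
pose A : 'M_(size s, n) := \matrix_(l, j) e j s`_l.
have [|P [Q PQ]] := @unit_block_of_local_rank R noethR i _ _ A.
  move=> p pX d pd; have [Fp [r [rk [FE FN]]]] := loc p pX.
  apply: (rk_ge_leq pX.1 (rk d pd)).
  have [y [f [Ny Ef nz]]] := dual_basis_minor pX.1 linE FE FN.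
  have /choice [U hU] j : exists a : 'I_(size s) -> R, y j = \sum_k a k *: s`_k.
    exact/gens.
  have /choice [W hW] j : exists w : 'I_n -> R, forall x, f j x = \sum_k w k * e k x.
    exact: gene.
  (* The local matrix [f_b(y_a)] factors through [A], so its determinant outside [p] bounds the rank
     of [A] from below. *)
  apply: (rk_ge_mul pX.1 (U := \matrix_j \row_k U j k) (W := \matrix_(k, j) W j k)).
  exists id, id; congr (~ p (\det _)): nz; apply/matrixP => a b; rewrite !mxE.
  rewrite hW; apply: eq_bigr => j _; rewrite !mxE mulrC; congr (_ * _).
  rewrite hU (R_linear_sum (linE _ (Ee j))); apply: eq_bigr => k _.
  by rewrite !mxE.
(* Rows of [P] give elements of [N], columns of [Q] give forms in [E], and [PQ] states that they are
   dual. *)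
pose y j := \sum_l P j l *: s`_l; pose f j x := \sum_k Q k j * e k x.
apply: (@free_summand_of_dual_bases E N i y f) => // [j|j|j l].
- by apply: submodule_sum => // k; apply: Ns.
- exact: Hom_submodule_sum.
have /matrixP/(_ j l) := PQ; rewrite !mxE => <-; apply: eq_bigr => k _.
rewrite mulrC mxE; congr (_ * _); rewrite (R_linear_sum (linE _ (Ee k))).
by apply: eq_bigr => m _; rewrite mxE.
Qed.
End Globalization.

Theorem theorem4p8 (R : comPzRingType) (M : lmodType R) (N : M -> Prop)
    (E : (M -> R) -> Prop) (i : nat) :
  noetherian R -> fin_gen_module M ->
  is_submodule N -> fin_gen_submodule N ->
  is_Hom_submodule E -> (0 < i)%N ->
  ((forall p : R -> Prop, in_jSpec p ->
      exists (Fp : M * R -> Prop) (r : nat),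
        rank_ge_plus_dim (@in_jSpec R) p i r /\ free_Ep_summand p E Fp r) ->
   exists (F : M -> Prop) (r : nat), (i <= r)%N /\ free_E_summand E F r) /\
  ((forall p : R -> Prop, in_jSpec p ->
      exists (Fp : M * R -> Prop) (r : nat),
        rank_ge_plus_dim (@in_jSpec R) p i r /\ free_Ep_summand p E Fp r /\
        (forall x, Fp x -> in_loc_sub p N x)) ->
   exists (F : M -> Prop) (r : nat),
     (i <= r)%N /\ free_E_summand E F r /\ (forall x, F x -> N x)).
Proof.
move=> noethR fgM hN fgN hE _; split=> loc; last first.
  have [F [FE FN]] := free_summand_in_submodule noethR fgM hN fgN hE loc.
  by exists F, i.
(* The first claim is the case of [N] equal to all of [M], where each valid fraction represents
   itself. *)
have [||F [FE _]] := @free_summand_in_submodule R noethR M (fun=> True) E i fgM _ fgM hE.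
- by [].
- move=> p pX; have [Fp [r [rk FE]]] := loc p pX; exists Fp, r; do !split=> //.
  move=> x Fx; have [b [G [c [_ [_ [hF _]]]]]] := FE.
  exists x.1, x.2; split=> //; split; first by have [] := (hF x).1 Fx.
  by apply: eqMp_cross => //; exact: pX.1.
by exists F, i.
Qed.
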